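(* Let $n\ge1$ and let two $B$-diagonals have arc representations $\{[u_1,v_1-1],[u_1+n+1,v_1+n]\}$ and $\{[u_2,v_2-1],[u_2+n+1,v_2+n]\}$. These two $B$-diagonals are noncrossing if and only if for every arc $I\in\{[u_1,v_1-1],[u_1+n+1,v_1+n]\}$ and every arc $J\in\{[u_2,v_2-1],[u_2+n+1,v_2+n]\}$, the arcs $I$ and $J$ are either nested (one contains the other) or disjoint.
   Context: Label the vertices of a regular $(2n+2)$-gon clockwise by $1,\ldots,n+1,\overline{1},\ldots,\overline{n+1}$, identify $\overline{i}$ with $n+1+i$, and read labels as elements of $\mathbb{Z}/(2n+2)\mathbb{Z}\subset\mathbb{R}/(2n+2)\mathbb{Z}$. A $B$-diagonal is either a diameter $\{i,\overline{i}\}$ ($1\le i\le n+1$), or an antipodal pair of diagonals $\{\{i,j\},\{\overline{i},\overline{j}\}\}$ with $1\le i<i+1<j\le n+1$, or $\{\{i,\overline{j}\},\{\overline{i},j\}\}$ with $1\le j<i\le n+1$. Two $B$-diagonals cross if a diagonal of one and a diagonal of the other meet in the interior of the polygon. Every $B$-diagonal can be written as $\{\{u,v\},\{u+n+1,v+n+1\}\}$ with $v-u\equiv d\pmod{2n+2}$ for some $d\in\{2,\ldots,n+1\}$; its arc representation is the centrally symmetric pair of closed arcs $\{[u,v-1],[u+n+1,v+n]\}$ on the circle $\mathbb{R}/(2n+2)\mathbb{Z}$, where $[x,y]$ denotes the arc traversed increasingly from $x$ to $y$ (of length less than $n+1$). This pair does not depend on the choices made. *)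

(* Defs.v *)
From HB Require Import structures.
From mathcomp Require Import all_boot all_order all_algebra ring_quotient.
From mathcomp Require Import all_classical all_reals all_analysis.

Set Implicit Arguments.
Unset Strict Implicit.
Unset Printing Implicit Defensive.

Import Order.TTheory GRing.Theory Num.Theory numFieldNormedType.Exports.
Local Open Scope classical_set_scope.
Local Open Scope ring_scope.

(* Labels of the (2n+2)-gon, i.e. Z/(2n+2)Z: the label i is i%:R and its
   antipode \bar i is bar i, with bar (n+1) = (2n+2)%:R = 0. *)
Notation label n := 'Z_(n.*2.+2).

Definition bar (n : nat) (x : label n) : label n := x + n.+1%:R.

(* ** B-diagonals, as sets of one or two diagonals *)

Definition is_diagonal (n : nat) (d : {set label n}) : Prop :=
  exists u v : label n,
    [/\ d = [set u; v]%SET, u != v, v != u + 1 & u != v + 1].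

(* The first conjunct excludes {{i, \bar j}, {\bar i, j}} with i = n+1 and
   j = 1, which is a pair of sides of the polygon. *)
Definition is_Bdiagonal (n : nat) (D : {set {set label n}}) : Prop :=
  (forall d, d \in D -> is_diagonal d) /\
  [\/ exists i : nat,
        (1 <= i <= n.+1)%N /\ D = [set [set i%:R; bar i%:R]]%SET,
      exists i j : nat,
        [/\ (1 <= i)%N, (i.+1 < j)%N, (j <= n.+1)%N
          & D = [set [set i%:R; j%:R]; [set bar i%:R; bar j%:R]]%SET]
    | exists i j : nat,
        [/\ (1 <= j)%N, (j < i)%N, (i <= n.+1)%N
          & D = [set [set i%:R; bar j%:R]; [set bar i%:R; j%:R]]%SET] ].

(* ** Crossing, in an arbitrary regular (2n+2)-gon *)

Definition hull (R : realType) (A : set (R^o * R^o)) : set (R^o * R^o) :=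
  smallest (@convex_set R (R^o * R^o)%type) A.

(* The minus sign makes the labels run clockwise. *)
Definition vertex (R : realType) (n : nat) (c : R^o * R^o) (r theta : R)
    (k : label n) : R^o * R^o :=
  let a := theta - 2 * pi * (k : nat)%:R / (n.*2.+2)%:R in
  (c.1 + r * cos a, c.2 + r * sin a).

Definition polygon (R : realType) (n : nat) (c : R^o * R^o) (r theta : R) :
    set (R^o * R^o) :=
  hull (range (@vertex R n c r theta)).

Definition chord (R : realType) (n : nat) (c : R^o * R^o) (r theta : R)
    (d : {set label n}) : set (R^o * R^o) :=
  hull (@vertex R n c r theta @` [set` d]).

(* A diagonal is not regarded as meeting itself. For distinct B-diagonals the
   condition d1 != d2 is automatic, as a B-diagonal is determined by any of its
   diagonals; it only makes a B-diagonal not cross itself. *)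
Definition crossing (R : realType) (n : nat) (c : R^o * R^o) (r theta : R)
    (D1 D2 : {set {set label n}}) : Prop :=
  exists d1 d2 : {set label n},
    [/\ d1 \in D1, d2 \in D2, d1 != d2
      & (chord c r theta d1 `&` chord c r theta d2
         `&` (polygon n c r theta)°) !=set0].

(* ** The circle R/(2n+2)Z and its arcs *)

Definition period_multiples (R : realType) (n : nat) : {pred R} :=
  [pred x | x / (n.*2.+2)%:R \is a Num.int].
Arguments period_multiples : clear implicits.

Lemma period_multiples_zmod_closed (R : realType) (n : nat) :
  zmod_closed (period_multiples R n).
Proof.
split=> [|x y]; rewrite !inE ?mul0r ?rpred0// => hx hy.
by rewrite mulrBl rpredB.
Qed.

HB.instance Definition _ (R : realType) (n : nat) :=
  GRing.isZmodClosed.Build R (period_multiples R n)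
    (period_multiples_zmod_closed R n).

Definition circle (R : realType) (n : nat) : Type :=
  Quotient.quot (period_multiples R n : zmodClosed R).

Definition circle_proj (R : realType) (n : nat) (x : R) : circle R n :=
  (\pi_(Quotient.quot (period_multiples R n : zmodClosed R)) x)%qT.

Definition label_circle (R : realType) (n : nat) (k : label n) : circle R n :=
  circle_proj n (k : nat)%:R.

(* [x, y]: the image of a real interval [a, b] of length less than 2n+2 whose
   endpoints lift x and y. *)
Definition circle_arc (R : realType) (n : nat) (x y : circle R n) :
    set (circle R n) :=
  [set z | exists a b t : R,
     [/\ circle_proj n a = x, circle_proj n b = y,
         a <= b < a + (n.*2.+2)%:R, a <= t <= b & circle_proj n t = z]].

(* ** Arc representations *)

Definition represents (n : nat) (u v : label n) (D : {set {set label n}}) :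
    Prop :=
  D = [set [set u; v]; [set u + n.+1%:R; v + n.+1%:R]]%SET /\
  exists2 d : nat, (2 <= d <= n.+1)%N & v - u = d%:R.

Definition arc_rep (R : realType) (n : nat) (u v : label n) :
    set (set (circle R n)) :=
  [set circle_arc (label_circle R u) (label_circle R (v - 1));
       circle_arc (label_circle R (u + n.+1%:R)) (label_circle R (v + n%:R))].

Definition nested (T : Type) (I J : set T) : Prop := I `<=` J \/ J `<=` I.

(* Main.v *)
(* Both sides are tested one pair of diagonals at a time. The diagonals {u, v}
   and {x, y} meet inside the polygon exactly when u, v and x, y alternate: the
   orientation of three vertices is 4 r^2 times a product of three sines whose
   signs are those of the differences of the labels, so alternation says that
   each diagonal strictly separates the endpoints of the other. Shortening
   [u, v] to [u, v - 1] makes arcs of adjacent diagonals disjoint or nested and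
   leaves alternating ones overlapping without nesting; since the arcs have
   length at most n, two of them never cover the circle. *)
Require Import Defs.
From mathcomp Require Import all_boot all_order all_algebra ring_quotient.
From mathcomp Require Import all_classical all_reals all_analysis.
From mathcomp Require Import zify ring lra.
Import Order.TTheory GRing.Theory Num.Theory numFieldNormedType.Exports.
Local Open Scope classical_set_scope.
Local Open Scope ring_scope.

(** * Alternation of labels *)

(** With the circle cut just before the label 0, this is the side of the diagonal that avoids the
    cut. *)
Definition between (a b x : nat) : bool := (minn a b < x < maxn a b)%N.

(* The labels a, b and x, y alternate around the polygon. *)
Definition separated (a b x y : nat) : bool :=
  [&& x != a, x != b, y != a, y != b & between a b x != between a b y].

Lemma separatedC (a b x y : nat) : a != b -> x != y ->
  separated a b x y = separated x y a b.
Proof. by rewrite /separated /between; lia. Qed.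

(** * Convex combinations, hulls and segments *)

Lemma convex_pairE (R : realType) (P Q : R^o * R^o) (t : {i01 R}) :
  conv t (P : convex_lmodType (R^o * R^o)%type) Q =
  (t%:num * P.1 + (1 - t%:num) * Q.1, t%:num * P.2 + (1 - t%:num) * Q.2).
Proof. by []. Qed.

Lemma convex_set_comb (R : realType) (S : set (R^o * R^o))
    (P Q : R^o * R^o) (t : R) :
  @convex_set R (R^o * R^o)%type S -> S P -> S Q -> 0 <= t <= 1 ->
  S ((1 - t) * P.1 + t * Q.1, (1 - t) * P.2 + t * Q.2).
Proof.
move=> cS SP SQ t01.
(* [conv] puts the weight [t] on its first point, hence the exchange of [P] and [Q]. *)
have := cS Q P (Itv01 (proj1 (andP t01)) (proj2 (andP t01))).
rewrite !inE => /(_ SQ SP); rewrite convex_pairE /=.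
by rewrite ![_ * _ + (1 - t) * _]addrC.
Qed.

Lemma hull_convex (R : realType) (A : set (R^o * R^o)) :
  @convex_set R (R^o * R^o)%type (hull A).
Proof.
move=> P Q t; rewrite !inE => hP hQ M [cM AM].
have := cM P Q t; rewrite !inE; apply; [exact: hP|exact: hQ].
Qed.

(** A closed half-plane is convex, so it is one of the sets that the hull intersects. *)
Lemma hull_halfplane (R : realType) (A : set (R^o * R^o)) (a b m : R) :
  (forall P, A P -> a * P.1 + b * P.2 <= m) ->
  forall P, hull A P -> a * P.1 + b * P.2 <= m.
Proof.
move=> AH P hP; apply: (hP [set P | a * P.1 + b * P.2 <= m]); split=> //.
move=> Q S t; rewrite !inE => /= hQ hS.
have t0 : 0 <= t%:num by [].
have t1 : t%:num <= 1 by [].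
rewrite -[_ <= m]/(a * (t%:num * Q.1 + (1 - t%:num) * S.1) +
  b * (t%:num * Q.2 + (1 - t%:num) * S.2) <= m).
set s := t%:num in t0 t1 *.
have := ler_wpM2l t0 hQ.
have : 0 <= 1 - s by lra.
move=> /ler_wpM2l /(_ _ _ hS); lra.
Qed.

Definition segment {R : realType} (P Q : R^o * R^o) : set (R^o * R^o) :=
  [set ((1 - t) * P.1 + t * Q.1, (1 - t) * P.2 + t * Q.2)
   | t in [set t : R | 0 <= t <= 1]].

Lemma segment_convex (R : realType) (A B : R^o * R^o) :
  @convex_set R (R^o * R^o)%type (segment A B).
Proof.
move=> Q S t; rewrite !inE => -[x /= x01 <-] [y /= y01 <-].
have t0 : 0 <= t%:num by [].
have t1 : t%:num <= 1 by [].
rewrite convex_pairE /=; set s := t%:num in t0 t1 *.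
exists (s * x + (1 - s) * y); last by congr pair; ring.
rewrite /=; nra.
Qed.

Lemma chord_segment (R : realType) (n : nat) (c : R^o * R^o) (r theta : R)
    (a b : label n) :
  chord c r theta [set a; b]%SET =
  segment (vertex c r theta a) (vertex c r theta b).
Proof.
apply/seteqP; split=> [P hP|P [t t01 <-]]; last first.
  apply: convex_set_comb => //; first exact: hull_convex.
  - by apply: sub_gen_smallest; exists a; rewrite //= !inE eqxx.
  - by apply: sub_gen_smallest; exists b; rewrite //= !inE eqxx orbT.
apply: (hP (segment _ _)); split=> [|Q [k /=]]; first exact: segment_convex.
rewrite !inE => /orP[] /eqP -> <-.
- exists 0; first by rewrite /= lexx ler01.
  by rewrite subr0 !mul1r !mul0r !addr0 -surjective_pairing.
- exists 1; first by rewrite /= lexx ler01.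
  by rewrite subrr !mul1r !mul0r !add0r -surjective_pairing.
Qed.

(** * Orientation and intersection of segments *)

(** Twice the signed area of the triangle [A B P]; its sign tells the side of the line [AB] on which
    [P] lies. *)
Definition orient {R : realType} (A B P : R^o * R^o) : R :=
  (B.1 - A.1) * (P.2 - A.2) - (B.2 - A.2) * (P.1 - A.1).

Lemma small_affine_near (R : realType) (a b e : R) (P : R^o * R^o) : 0 < e ->
  \forall Q \near P, `|a * (Q.1 - P.1) + b * (Q.2 - P.2)| < e.
Proof.
move=> e0; apply/nbhs_ballP.
have K0 : 0 < `|a| + `|b| + 1 by rewrite ltr_wpDl// addr_ge0.
exists (e / (`|a| + `|b| + 1)); first by rewrite /= divr_gt0.
move=> Q [/=]; rewrite -!ball_normE /= => h1 h2.
apply: le_lt_trans (ler_normD _ _) _.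
rewrite !normrM ![`|Q.1 - _|]distrC ![`|Q.2 - _|]distrC.
set d := e / _ in h1 h2.
have d0 : 0 < d by rewrite divr_gt0.
have -> : e = (`|a| + `|b| + 1) * d by rewrite mulrC divfK ?gt_eqF.
have := ler_wpM2l (normr_ge0 a) (ltW h1).
have := ler_wpM2l (normr_ge0 b) (ltW h2).
lra.
Qed.

(** The sign conditions put the crossing point strictly inside both segments. Their directions are
    independent, so small moves along the two fill a neighbourhood inside [S]. *)
Lemma segments_cross_interior (R : realType) (S : set (R^o * R^o))
    (A B X Y : R^o * R^o) :
  @convex_set R (R^o * R^o)%type S -> S A -> S B -> S X -> S Y ->
  orient A B X * orient A B Y < 0 -> orient X Y A * orient X Y B < 0 ->
  (segment A B `&` segment X Y `&` S°) !=set0.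
Proof.
move=> cS SA SB SX SY hXY hAB.
have hh : 0 <= (1 / 2 : R) <= 1 by lra.
(* [D] is the determinant of [Y - X] and [B - A]; by Cramer's rule [t] and [s] are the parameters of
   the crossing point on [XY] and on [AB]. *)
pose D := orient A B X - orient A B Y.
have DE : orient X Y B - orient X Y A = D by rewrite /D /orient; ring.
have D0 : D != 0 by apply/eqP => D0; rewrite /D in D0; nra.
pose t := orient A B X / D; pose s := - orient X Y A / D.
have ratio (p q : R) : p * q < 0 -> 0 < p / (p - q) < 1.
  move=> pq; have [p0|p0] := ltP 0 p.
    have d0 : 0 < p - q by nra.
    by rewrite divr_gt0//= ltr_pdivrMr// mul1r; nra.
  have d0 : 0 < q - p by nra.
  by rewrite -opprB invrN mulrN -mulNr divr_gt0 ?ltr_pdivrMr// ?mul1r; nra.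
have t01 : 0 < t < 1 by exact: ratio.
have s01 : 0 < s < 1.
  by rewrite /s -DE -opprB invrN mulrNN; exact: ratio.
pose P : R^o * R^o := ((1 - t) * X.1 + t * Y.1, (1 - t) * X.2 + t * Y.2).
have PE : P = ((1 - s) * A.1 + s * B.1, (1 - s) * A.2 + s * B.2).
  rewrite /P /s /t; congr pair; move: D0; rewrite /D /orient => D0;
    field; exact: D0.
exists P; split; first split.
- by exists s; [rewrite /=; lra|rewrite PE].
- by exists t => //=; lra.
(* Half of the smallest margin of [s] and [t] in [0, 1], since both parameters will move by up to
   [2 * e]. *)
pose e := Num.min (Num.min s (1 - s)) (Num.min t (1 - t)) / 2.
have e0 : 0 < e by rewrite divr_gt0// !lt_min; lra.
have [es es' et et'] : [/\ 2 * e <= s, 2 * e <= 1 - s, 2 * e <= t & 2 * e <= 1 - t].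
  by rewrite /e mulrC divfK ?pnatr_eq0// !ge_min !lexx !orbT.
have P1 : P.1 = (1 - s) * A.1 + s * B.1 by rewrite PE.
have P2 : P.2 = (1 - s) * A.2 + s * B.2 by rewrite PE.
have P1' : P.1 = (1 - t) * X.1 + t * Y.1 by [].
have P2' : P.2 = (1 - t) * X.2 + t * Y.2 by [].
clearbody P s t.
(* The displacement Q - P is x (B - A) + y (Y - X) with small x and y. Sliding
   along AB by 2x and along XY by 2y gives two points with midpoint Q. *)
have nx := small_affine_near _ (- (Y.2 - X.2) / D) ((Y.1 - X.1) / D) _ P e0.
have ny := small_affine_near _ ((B.2 - A.2) / D) (- (B.1 - A.1) / D) _ P e0.
suff : \forall Q \near P, S Q by [].
apply: filterS (filterI nx ny) => Q /=.
set x := _ + _; set y := (X in _ /\ `|X| < e) => -[].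
rewrite !ltr_norml => /andP[x1 x2] /andP[y1 y2].
have Q1 : Q.1 - P.1 = x * (B.1 - A.1) + y * (Y.1 - X.1).
  by rewrite /x /y; move: D0; rewrite /D /orient => D0; field; exact: D0.
have Q2 : Q.2 - P.2 = x * (B.2 - A.2) + y * (Y.2 - X.2).
  by rewrite /x /y; move: D0; rewrite /D /orient => D0; field; exact: D0.
have hA : 0 <= s + 2 * x <= 1 by lra.
have hX : 0 <= t + 2 * y <= 1 by lra.
have := convex_set_comb _ _ _ _ _ cS (convex_set_comb _ _ _ _ _ cS SA SB hA)
  (convex_set_comb _ _ _ _ _ cS SX SY hX) hh.
set Q' := (_, _); suff -> : Q = Q' by [].
apply: etrans (surjective_pairing Q) _; congr pair => /=.
- have -> : Q.1 = x * (B.1 - A.1) + y * (Y.1 - X.1) + (P.1 + P.1) / 2.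
    by rewrite -Q1; lra.
  by rewrite {1}P1 P1'; field.
- have -> : Q.2 = x * (B.2 - A.2) + y * (Y.2 - X.2) + (P.2 + P.2) / 2.
    by rewrite -Q2; lra.
  by rewrite {1}P2 P2'; field.
Qed.

(** [orient A B] is affine along [XY] and vanishes at the common point. Without a sign change, and
    not being zero at both ends, it can vanish only at an end. *)
Lemma segments_disjoint (R : realType) (A B X Y P : R^o * R^o) :
  segment A B P -> segment X Y P -> 0 <= orient A B X * orient A B Y ->
  orient A B X != 0 \/ orient A B Y != 0 -> P = X \/ P = Y.
Proof.
move=> [s /= s01 <-] [t /= t01 []].
move=> e1 e2.
have on_line :
    orient A B ((1 - t) * X.1 + t * Y.1, (1 - t) * X.2 + t * Y.2) = 0.
  by rewrite e1 e2 /orient /=; ring.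
have h0 : (1 - t) * orient A B X + t * orient A B Y = 0.
  by rewrite -on_line /orient /=; ring.
rewrite -e1 -e2 => hXY nz.
have [t1|t0] : t = 1 \/ t = 0; [|right|left].
(* Multiplying [h0] by the nonzero end value leaves two nonnegative terms of sum 0, so the
   coefficient of the square is 0. *)
- case: nz => nz; [left|right].
  + have := mulr_ge0 (proj1 (andP t01)) hXY.
    have := exprn_even_gt0 (orient A B X) (isT : ~~ odd 2); rewrite nz /= => o2.
    have : (1 - t) * orient A B X ^+ 2 + t * (orient A B X * orient A B Y) = 0.
      by rewrite -(mulr0 (orient A B X)) -h0; ring.
    move: t01 => /andP[_ t1] h h'.
    have : (1 - t) * orient A B X ^+ 2 <= 0 by lra.
    by rewrite pmulr_lle0//; lra.
  + have : 0 <= (1 - t) * (orient A B X * orient A B Y).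
      by rewrite mulr_ge0//; lra.
    have := exprn_even_gt0 (orient A B Y) (isT : ~~ odd 2); rewrite nz /= => o2.
    have : (1 - t) * (orient A B X * orient A B Y) + t * orient A B Y ^+ 2 = 0.
      by rewrite -(mulr0 (orient A B Y)) -h0; ring.
    move: t01 => /andP[t0 _] h h'.
    have : t * orient A B Y ^+ 2 <= 0 by lra.
    by rewrite pmulr_lle0//; lra.
- by rewrite t1 subrr !mul1r !mul0r !add0r -surjective_pairing.
- by rewrite t0 subr0 !mul1r !mul0r !addr0 -surjective_pairing.
Qed.

(** * The regular polygon: its interior and the orientation of its vertices *)

(** Used so that a common endpoint of two diagonals does not count as a crossing. *)
Lemma vertex_notin_interior (R : realType) (n : nat) (c : R^o * R^o)
    (r theta : R) (k : label n) : 0 < r ->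
  ~ (polygon n c r theta)° (vertex c r theta k).
Proof.
move=> r0 /nbhs_ballP [e /= e0 he].
have angle (j : label n) : exists f : R,
  vertex c r theta j = (c.1 + r * cos f, c.2 + r * sin f) by eexists.
have [f fE] := angle k.
(* The tangent to the circumcircle at the vertex bounds the polygon. *)
have top P : polygon n c r theta P ->
    cos f * P.1 + sin f * P.2 <= cos f * c.1 + sin f * c.2 + r.
  apply: hull_halfplane => _ [j _ <-]; have [g ->] := angle j; rewrite /=.
  have : cos (f - g) <= 1 by exact: cos_le1.
  by rewrite cosB => /(ler_wpM2l (ltW r0)); lra.
(* The vertex pushed outwards along its radius by [e / 2]: still in the ball, but beyond the
   tangent. *)
pose Q : R^o * R^o :=
  (c.1 + r * cos f + e / 2 * cos f, c.2 + r * sin f + e / 2 * sin f).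
have /he /top : ball (vertex c r theta k) e Q.
  rewrite fE; split; rewrite -ball_normE /= opprD addrA subrr add0r normrN.
  - rewrite normrM; have := cos_max f; have := normr_ge0 (cos f).
    rewrite gtr0_norm; nra.
  - rewrite normrM; have := sin_max f; have := normr_ge0 (sin f).
    rewrite gtr0_norm; nra.
rewrite /Q /=; have := cos2Dsin2 f; nra.
Qed.

(* 2 r |half_sin a b| is the distance between the vertices a and b. *)
Definition half_sin (R : realType) (n : nat) (a b : nat) : R :=
  sin (pi * (a%:R - b%:R) / (n.*2.+2)%:R).

Lemma half_sin_gt0 (R : realType) (n a b : nat) :
  (b < a < n.*2.+2)%N -> 0 < half_sin R n a b.
Proof.
move=> /andP[ba an]; apply: sin_gt0_pi.
have N0 : (0 : R) < (n.*2.+2)%:R by rewrite ltr0n.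
have h : (b%:R : R) < a%:R by rewrite ltr_nat.
have h' : (a%:R : R) < (n.*2.+2)%:R by rewrite ltr_nat.
have b0 : (0 : R) <= b%:R by rewrite ler0n.
rewrite divr_gt0 ?mulr_gt0 ?pi_gt0 ?subr_gt0//=.
by rewrite ltr_pdivrMr// ltr_pM2l ?pi_gt0//; lra.
Qed.

Lemma half_sinC (R : realType) (n a b : nat) :
  half_sin R n b a = - half_sin R n a b.
Proof. by rewrite /half_sin -sinN; congr sin; ring. Qed.

Lemma half_sin0 (R : realType) (n a : nat) : half_sin R n a a = 0.
Proof. by rewrite /half_sin subrr mulr0 mul0r sin0. Qed.

(** Turns a sum over central angles into a product over the inscribed angles, which are half as
    large. *)
Lemma sin_triangle (R : realType) (p q : R) :
  sin (p *+ 2) + sin (q *+ 2) - sin (p *+ 2 + q *+ 2) =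
  4 * sin p * sin q * sin (p + q).
Proof.
rewrite (sinD (p *+ 2)) (sinD p) !sin_mulr2n !cos_mulr2n.
move: (cos2Dsin2 p) (cos2Dsin2 q).
by move=> /(canRL (addrK _)) -> /(canRL (addrK _)) ->; ring.
Qed.

(** The inscribed triangle is the signed sum of the three triangles that its sides form with the
    centre. *)
Lemma orient_circle (R : realType) (c : R^o * R^o) (r f g h : R) :
  orient (c.1 + r * cos f, c.2 + r * sin f) (c.1 + r * cos g, c.2 + r * sin g)
    (c.1 + r * cos h, c.2 + r * sin h) =
  r ^+ 2 * (sin (g - f) + sin (h - g) - sin (h - f)).
Proof. rewrite !sinB /orient /=; ring. Qed.

(* As the labels run over [0, 2n+2), each of the three half_sin has the sign of
   the difference of its labels. *)
Lemma orient_vertex (R : realType) (n : nat) (c : R^o * R^o) (r theta : R)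
    (a b x : label n) :
  orient (vertex c r theta a) (vertex c r theta b) (vertex c r theta x) =
  4 * r ^+ 2 * half_sin R n a b * (half_sin R n b x * half_sin R n a x).
Proof.
pose ang (k : label n) := theta - 2 * pi * (k : nat)%:R / (n.*2.+2)%:R.
pose p : R := pi * (a%:R - b%:R) / (n.*2.+2)%:R.
pose q : R := pi * (b%:R - x%:R) / (n.*2.+2)%:R.
have -> : half_sin R n a x = sin (p + q).
  by rewrite /half_sin /p /q; congr sin; ring.
have -> : orient (vertex c r theta a) (vertex c r theta b) (vertex c r theta x) =
    r ^+ 2 * (sin (ang b - ang a) + sin (ang x - ang b) - sin (ang x - ang a)).
  exact: orient_circle.
have -> : ang b - ang a = p *+ 2 by rewrite /ang /p; ring.
have -> : ang x - ang b = q *+ 2 by rewrite /ang /q; ring.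
have -> : ang x - ang a = p *+ 2 + q *+ 2 by rewrite /ang /p /q; ring.
by rewrite sin_triangle /half_sin -/p -/q; ring.
Qed.

Lemma half_sin_eq0 (R : realType) (n : nat) (a b : label n) :
  (half_sin R n a b == 0) = (a == b).
Proof.
have := ltn_ord a; have := ltn_ord b; rewrite /Zp_trunc /= => bn an.
have [ba|ab|/val_inj ->] := ltngtP b a; last by rewrite half_sin0 !eqxx.
- by rewrite -val_eqE gt_eqF ?half_sin_gt0 ?ba// gtn_eqF.
- by rewrite -val_eqE half_sinC oppr_eq0 gt_eqF ?half_sin_gt0 ?ab// ltn_eqF.
Qed.

Lemma half_sin_mul_lt0 (R : realType) (n a b x : nat) :
  (a < n.*2.+2)%N -> (b < n.*2.+2)%N -> (x < n.*2.+2)%N ->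
  (half_sin R n b x * half_sin R n a x < 0) = between a b x.
Proof.
rewrite /between => an bn xn.
have [xb|bx|->] := ltngtP x b; last by rewrite half_sin0 mul0r ltxx; lia.
- rewrite pmulr_rlt0 ?half_sin_gt0 ?xb//.
  have [xa|ax|->] := ltngtP x a; last by rewrite half_sin0 ltxx; lia.
  + by rewrite ltNge ltW ?half_sin_gt0 ?xa//=; lia.
  + by rewrite half_sinC oppr_lt0 half_sin_gt0 ?ax//=; lia.
- have h : 0 < half_sin R n x b by rewrite half_sin_gt0 ?bx.
  rewrite half_sinC mulNr oppr_lt0 (pmulr_rgt0 _ h).
  have [xa|ax|->] := ltngtP x a; last by rewrite half_sin0 ltxx; lia.
  + by rewrite half_sin_gt0 ?xa//=; lia.
  + by rewrite half_sinC oppr_gt0 ltNge ltW ?half_sin_gt0 ?ax//=; lia.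
Qed.

Lemma orient_factor_neq0 (R : realType) (n : nat) (r : R) (a b : label n) :
  0 < r -> a != b -> 4 * r ^+ 2 * half_sin R n a b != 0.
Proof.
move=> r0 ab; rewrite mulf_neq0 ?half_sin_eq0//.
by rewrite gt_eqF// mulr_gt0// exprn_gt0.
Qed.

Lemma orient_vertex_eq0 (R : realType) (n : nat) (c : R^o * R^o) (r theta : R)
    (a b x : label n) : 0 < r -> a != b ->
  (orient (vertex c r theta a) (vertex c r theta b) (vertex c r theta x) == 0) =
  (x == a) || (x == b).
Proof.
move=> r0 ab; rewrite orient_vertex mulf_eq0.
by rewrite (negPf (orient_factor_neq0 _ _ _ _ _ r0 ab)) /= mulf_eq0
  !half_sin_eq0 orbC ![_ == x]eq_sym.
Qed.

Lemma orient_vertex_mul_lt0 (R : realType) (n : nat) (c : R^o * R^o)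
    (r theta : R) (a b x y : label n) : 0 < r -> a != b ->
  (orient (vertex c r theta a) (vertex c r theta b) (vertex c r theta x) *
   orient (vertex c r theta a) (vertex c r theta b) (vertex c r theta y) < 0) =
  separated a b x y.
Proof.
(* The factor depending only on [a] and [b] occurs twice, so it contributes a positive square. *)
move=> r0 ab; rewrite !orient_vertex mulrACA pmulr_rlt0; last first.
  by rewrite -expr2 exprn_even_gt0//= orient_factor_neq0.
have f0 (z : label n) :
    (z == a) || (z == b) = (half_sin R n b z * half_sin R n a z == 0).
  by rewrite mulf_eq0 !half_sin_eq0 orbC ![_ == z]eq_sym.
have -> : separated a b x y =
    [&& ~~ ((x == a) || (x == b)), ~~ ((y == a) || (y == b))
      & between a b x != between a b y].
  by rewrite /separated !val_eqE !negb_or -!andbA.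
rewrite !f0 -!(half_sin_mul_lt0 R n); try exact: ltn_ord.
set fx := _ * half_sin R n a x; set fy := _ * half_sin R n a y.
have [x0|x0|->] := ltrgt0P fx; last by rewrite mul0r ltxx.
- rewrite pmulr_rlt0//; case: ltrgt0P => //=.
- rewrite nmulr_rlt0//; case: ltrgt0P => //=.
Qed.

Lemma chords_meetP (R : realType) (n : nat) (c : R^o * R^o) (r theta : R)
    (a b x y : label n) :
  0 < r -> a != b -> x != y -> [set a; b]%SET != [set x; y]%SET ->
  (chord c r theta [set a; b]%SET `&` chord c r theta [set x; y]%SET
     `&` (polygon n c r theta)°) !=set0 <-> separated a b x y.
Proof.
move=> r0 ab xy d12; rewrite !chord_segment; split; last first.
  move=> sep; have inP (k : label n) : polygon n c r theta (vertex c r theta k).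
    by apply: sub_gen_smallest; exists k.
  apply: segments_cross_interior; rewrite ?orient_vertex_mul_lt0//.
  - exact: hull_convex.
  - by rewrite -separatedC.
move=> [P [[abP xyP] inP]]; apply/negPn/negP.
rewrite -(orient_vertex_mul_lt0 R n c r theta)// -leNgt => nsep.
have notV (k : label n) : P != vertex c r theta k.
  by apply/eqP => PE; rewrite PE in inP; exact: vertex_notin_interior r0 inP.
have [] := segments_disjoint _ _ _ _ _ _ abP xyP nsep; last 2 first.
- by move=> PE; have := notV x; rewrite PE eqxx.
- by move=> PE; have := notV y; rewrite PE eqxx.
(* If [x] and [y] were both on the line through [a] and [b], the two diagonals would coincide,
   against [d12]. *)
rewrite !orient_vertex_eq0//.
have [xab|] := boolP (_ || _); last by left.
have [yab|] := boolP (_ || _); last by right.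
case/negP: d12; move: xab yab ab xy => /orP[]/eqP -> /orP[]/eqP -> // _;
  rewrite ?eqxx// => _.
by rewrite finset.setUC.
Qed.

(** * Arcs of the circle with integer endpoints *)

Lemma circle_projP (R : realType) (n : nat) (x y : R) :
  circle_proj n x = circle_proj n y <->
  exists k : int, x = y + k%:~R * (n.*2.+2)%:R.
Proof.
rewrite /circle_proj; split.
- move/eqP; rewrite -Quotient.idealrBE inE => /intrP [k hk].
  exists k; rewrite -hk divfK ?pnatr_eq0//; ring.
- move=> [k ->]; apply/eqP; rewrite -Quotient.idealrBE inE.
  by apply/intrP; exists k; rewrite addrAC subrr add0r mulfK ?pnatr_eq0.
Qed.

Lemma ltr_intM (R : realType) (x : R) (j k : int) : 0 < x ->
  (j%:~R * x < k%:~R * x) = (j < k).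
Proof. by move=> x0; rewrite ltr_pM2r// ltr_int. Qed.

Lemma intrDMn (R : realType) (a k : int) (m : nat) :
  (a + k * m%:Z)%:~R = a%:~R + k%:~R * m%:R :> R.
Proof. by rewrite rmorphD rmorphM. Qed.

Lemma intrDn (R : realType) (a : int) (m : nat) :
  (a + m%:Z)%:~R = a%:~R + m%:R :> R.
Proof. by rewrite rmorphD. Qed.

(** Integer lifts of the endpoints reduce nesting and disjointness to integer inequalities up to a
    shift by [k] periods. *)
Definition arc (R : realType) (n : nat) (a b : int) : set (circle R n) :=
  [set circle_proj n t | t in [set t : R | a%:~R <= t <= b%:~R]].

Lemma arcP (R : realType) (n : nat) (a b : int) (t : R) :
  arc R n a b (circle_proj n t) <->
  exists k : int, a%:~R <= t + k%:~R * (n.*2.+2)%:R <= b%:~R.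
Proof.
split=> [[s hs /circle_projP [k hk]]|[k hk]]; first by exists k; rewrite -hk.
by exists (t + k%:~R * (n.*2.+2)%:R) => //; apply/circle_projP; exists k.
Qed.

(** Any other lift of the endpoints shifts them by [k] and [l] periods; as both lengths lie in [0,
    2n+2), [k = l]. *)
Lemma circle_arcE (R : realType) (n : nat) (a b : int) :
  a <= b < a + (n.*2.+2)%:Z ->
  circle_arc (circle_proj n (a%:~R : R)) (circle_proj n b%:~R) = arc R n a b.
Proof.
move=> /andP[ab bN].
have N0 : (0 : R) < (n.*2.+2)%:R by rewrite ltr0n.
have abR : (a%:~R : R) <= b%:~R by rewrite ler_int.
have bNR : (b%:~R : R) < a%:~R + (n.*2.+2)%:R.
  by rewrite -(ltr_int R) rmorphD /= in bN.
apply/seteqP; split=> [z [a' [b' [t [ha hb hab ht <-]]]]|z [t ht <-]]; last first.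
  by exists a%:~R, b%:~R, t; split=> //; apply/andP.
move/circle_projP: ha hab ht => [k ->]; move/circle_projP: hb => [l ->].
move=> hab ht.
have kl : k < l + 1 by rewrite -(ltr_intM _ _ _ _ N0) rmorphD /= mulrDl mul1r; lra.
have lk : l < k + 1 by rewrite -(ltr_intM _ _ _ _ N0) rmorphD /= mulrDl mul1r; lra.
have {lk}kl : l = k by lia.
apply/arcP; exists (- k); rewrite rmorphN /= mulNr; rewrite kl in ht; lra.
Qed.

Lemma arc_sub (R : realType) (n : nat) (a b a' b' k : int) :
  a <= a' + k * (n.*2.+2)%:Z -> b' + k * (n.*2.+2)%:Z <= b ->
  arc R n a' b' `<=` arc R n a b.
Proof.
rewrite -!(ler_int R) !intrDMn => h h' z [t /= ht <-].
by apply/arcP; exists k; lra.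
Qed.

(** The shifted second arc fits in the gap between the first arc and its next lift; a common point
    would give an integer strictly between [- k] and [- k + 1]. *)
Lemma arc_disjoint (R : realType) (n : nat) (a b a' b' k : int) :
  b < a' + k * (n.*2.+2)%:Z -> b' + k * (n.*2.+2)%:Z < a + (n.*2.+2)%:Z ->
  arc R n a b `&` arc R n a' b' = set0.
Proof.
rewrite -!(ltr_int R) !intrDMn intrDn => h h'.
apply/seteqP; split=> // z [] [t /= ht <-] /arcP [j hj].
have N0 : (0 : R) < (n.*2.+2)%:R by rewrite ltr0n.
have lo : - k < j by rewrite -(ltr_intM _ _ _ _ N0) rmorphN /= mulNr; lra.
have hi : j < - k + 1.
  by rewrite -(ltr_intM _ _ _ _ N0) rmorphD rmorphN /= mulrDl mulNr mul1r; lra.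
lia.
Qed.

(* The lift of the second arc by k periods straddles the right endpoint of the
   first one; the last hypothesis keeps it from reaching the left endpoint from
   the other side of the circle. *)
Lemma arc_overlap (R : realType) (n : nat) (a b a' b' k : int) :
  a < a' + k * (n.*2.+2)%:Z -> a' + k * (n.*2.+2)%:Z <= b ->
  b < b' + k * (n.*2.+2)%:Z -> b' + k * (n.*2.+2)%:Z < a + (n.*2.+2)%:Z ->
  ~ (nested (arc R n a b) (arc R n a' b') \/
     arc R n a b `&` arc R n a' b' = set0).
Proof.
rewrite -!(ltr_int R) -!(ler_int R) !intrDMn intrDn => r1 r2 r3 r4.
have N0 : (0 : R) < (n.*2.+2)%:R by rewrite ltr0n.
(* The witnesses are [a], missed by the second arc, [b'], missed by the first, and [a'], common to
   both. *)
case=> [[sub|sub]|disj].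
- have /sub /arcP [j hj] : arc R n a b (circle_proj n a%:~R).
    by exists a%:~R => //; apply/andP; split; lra.
  have lo : - j < k by rewrite -(ltr_intM _ _ _ _ N0) rmorphN /= mulNr; lra.
  have hi : k < - j + 1.
    by rewrite -(ltr_intM _ _ _ _ N0) rmorphD rmorphN /= mulrDl mulNr mul1r; lra.
  lia.
- have /sub /arcP [j hj] : arc R n a' b' (circle_proj n b'%:~R).
    by exists b'%:~R => //; apply/andP; split; lra.
  have lo : j < k by rewrite -(ltr_intM _ _ _ _ N0); lra.
  have hi : k < j + 1 by rewrite -(ltr_intM _ _ _ _ N0) rmorphD /= mulrDl mul1r; lra.
  lia.
- have : (arc R n a b `&` arc R n a' b') (circle_proj n a'%:~R).
    split; first by apply/arcP; exists k; lra.
    by exists a'%:~R => //; apply/andP; split; lra.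
  by rewrite disj.
Qed.

(** * Arcs of diagonals compared with alternation *)

Lemma label_circle_nat (R : realType) (n k : nat) :
  label_circle R (k%:R : label n) = circle_proj n k%:R.
Proof.
rewrite /label_circle val_Zp_nat//; apply/circle_projP.
exists (- (k %/ n.*2.+2)%N%:Z).
rewrite {2}(divn_eq k n.*2.+2) natrD natrM rmorphN /= mulNr.
rewrite -pmulrn; ring.
Qed.

Lemma circle_arc_label (R : realType) (n d : nat) (u v : label n) :
  (2 <= d <= n.+1)%N -> v - u = d%:R ->
  circle_arc (label_circle R u) (label_circle R (v - 1)) =
  arc R n (u : nat)%:Z ((u : nat) + d.-1)%N%:Z.
Proof.
move=> hd vu.
have -> : v - 1 = ((u : nat) + d.-1)%N%:R.
  rewrite natrD natr_Zp -[d.-1]subn1 natrB -?vu; last lia.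
  by rewrite addrCA addrA subrK.
rewrite label_circle_nat /label_circle !pmulrn.
by apply: circle_arcE; lia.
Qed.

(** With [u] and [x] lifted to [0, 2n+2), the labels [v] and [y] are [u + d] and [x + e] minus at
    most one turn, which leaves linear arithmetic in each relative position. *)
Lemma arcs_nestedP (R : realType) (n d e : nat) (u v x y : label n) :
  (2 <= d <= n.+1)%N -> v - u = d%:R -> (2 <= e <= n.+1)%N -> y - x = e%:R ->
  let I := circle_arc (label_circle R u) (label_circle R (v - 1)) in
  let J := circle_arc (label_circle R x) (label_circle R (y - 1)) in
  (nested I J \/ I `&` J = set0) <-> ~~ separated u v x y.
Proof.
move=> hd vu he yx /=.
rewrite (circle_arc_label _ _ _ _ _ hd vu) (circle_arc_label _ _ _ _ _ he yx).
have add_label (w z : label n) (f : nat) : z - w = f%:R ->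
    z = (((w : nat) + f) %% n.*2.+2)%N :> nat.
  by move/(canRL (subrK _)) => ->; rewrite addrC -{1}[w]natr_Zp -natrD val_Zp_nat.
rewrite (add_label _ _ _ vu) (add_label _ _ _ yx).
have := ltn_ord x; have := ltn_ord u; rewrite /Zp_trunc /= => un xn.
move: (nat_of_ord u) (nat_of_ord x) un xn => {vu}u {yx}x un xn {v y add_label}.
have wrap w f : (w < n.*2.+2)%N -> (f <= n.+1)%N ->
   (((w + f) %% n.*2.+2)%N = (w + f)%N) \/
   ((n.*2.+2 <= w + f)%N /\ ((w + f) %% n.*2.+2 + n.*2.+2)%N = (w + f)%N).
  move=> hw hf; have [h|h] := ltnP (w + f)%N n.*2.+2; [left|right].
    by rewrite modn_small.
  by rewrite -{1}(subnK h) modnDr modn_small//; lia.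
have := wrap _ _ un (proj2 (andP hd)); have := wrap _ _ xn (proj2 (andP he)).
have := ltn_pmod (u + d)%N (isT : (0 < n.*2.+2)%N).
have := ltn_pmod (x + e)%N (isT : (0 < n.*2.+2)%N).
move: ((u + d) %% _)%N ((x + e) %% _)%N => v y yn vn hy hv {wrap}.
split=> [nest|].
- apply/negP => sep.
  have [] : (exists k : int,
    [/\ u%:Z < x%:Z + k * (n.*2.+2)%:Z,
        x%:Z + k * (n.*2.+2)%:Z <= (u + d.-1)%N%:Z,
        (u + d.-1)%N%:Z < (x + e.-1)%N%:Z + k * (n.*2.+2)%:Z
      & (x + e.-1)%N%:Z + k * (n.*2.+2)%:Z < u%:Z + (n.*2.+2)%:Z]) \/
     (exists k : int,
    [/\ x%:Z < u%:Z + k * (n.*2.+2)%:Z,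
        u%:Z + k * (n.*2.+2)%:Z <= (x + e.-1)%N%:Z,
        (x + e.-1)%N%:Z < (u + d.-1)%N%:Z + k * (n.*2.+2)%:Z
      & (u + d.-1)%N%:Z + k * (n.*2.+2)%:Z < x%:Z + (n.*2.+2)%:Z]).
    move: sep; rewrite /separated /between.
    (* The arc starting first either reaches the start of the other ([k = 0]), or it is reached by
       the other across the label 0 ([k = 1]). *)
    have [xu|ux] := leqP x u; [have [?|?] := ltnP u (x + e)%N
                              | have [?|?] := ltnP x (u + d)%N] => sep.
    - by right; exists 0; split; lia.
    - by left; exists 1; split; lia.
    - by left; exists 0; split; lia.
    - by right; exists 1; split; lia.
  + by case=> k [] /arc_overlap /[apply] /[apply] /[apply] /(_ R).
  + case=> k [] /arc_overlap /[apply] /[apply] /[apply] /(_ R) no; apply: no.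
    by case: nest => [[]|]; rewrite /nested setIC; tauto.
- move=> nosep.
  (* Again [k = 1] compares one arc with the next lift of the other. As [d + e] is at most 2n+2, the
     arcs cannot overlap at both ends. *)
  have : (exists k : int,
     [\/ u%:Z <= x%:Z + k * (n.*2.+2)%:Z
            /\ (x + e.-1)%N%:Z + k * (n.*2.+2)%:Z <= (u + d.-1)%N%:Z,
        x%:Z <= u%:Z + k * (n.*2.+2)%:Z
            /\ (u + d.-1)%N%:Z + k * (n.*2.+2)%:Z <= (x + e.-1)%N%:Z
      | (u + d.-1)%N%:Z < x%:Z + k * (n.*2.+2)%:Z
            /\ (x + e.-1)%N%:Z + k * (n.*2.+2)%:Z < u%:Z + (n.*2.+2)%:Z]).
    move: nosep; rewrite /separated /between.
    have [ux|xu] := leqP u x.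
    - have [?|?] := ltnP x (u + d)%N.
        have [?|?] := leqP (x + e)%N (u + d)%N => nosep; exists 0.
          by apply: Or31; lia.
        by apply: Or32; lia.
      have [?|?] := leqP (x + e)%N (u + n.*2.+2)%N => nosep.
        by exists 0; apply: Or33; lia.
      by exists 1; apply: Or32; lia.
    - have [?|?] := ltnP u (x + e)%N => nosep.
        by exists 0; apply: Or32; lia.
      have [?|?] := leqP (u + d)%N (x + n.*2.+2)%N; exists 1.
        by apply: Or33; lia.
      by apply: Or31; lia.
  case=> k [] [h h'].
  + by left; right; apply: arc_sub h h'.
  + by left; left; apply: arc_sub h h'.
  + by right; apply: arc_disjoint h h'.
Qed.

Lemma label_neq (n d : nat) (u v : label n) :
  (2 <= d <= n.+1)%N -> v - u = d%:R -> u != v.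
Proof.
move=> hd; apply: contra_eq_neq => ->; rewrite subrr eq_sym.
by rewrite -val_eqE /= val_Zp_nat// modn_small; lia.
Qed.

(** Matches diagonals with arcs in both directions, with one [d] for both antipodal copies, so that
    single pairs can be compared. *)
Lemma representsP (R : realType) (n : nat) (u v : label n)
    (D : {set {set label n}}) : represents u v D ->
  let arc_of (w z : label n) := circle_arc (label_circle R w) (label_circle R (z - 1)) in
  exists2 d : nat, (2 <= d <= n.+1)%N &
    (forall s, s \in D -> exists w z : label n,
       [/\ z - w = d%:R, s = [set w; z]%SET & arc_rep u v (arc_of w z)]) /\
    (forall I, arc_rep u v I -> exists w z : label n,
       [/\ z - w = d%:R, [set w; z]%SET \in D & I = arc_of w z]).
Proof.
move=> [-> [d hd vu]] arc_of; exists d => //.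
have vu' : v + n.+1%:R - (u + n.+1%:R) = d%:R by rewrite opprD addrACA subrr addr0.
(* [v + n] is the predecessor of the antipode of [v]. *)
have arcE : circle_arc (label_circle R (u + n.+1%:R)) (label_circle R (v + n%:R)) =
    arc_of (u + n.+1%:R) (v + n.+1%:R).
  by rewrite /arc_of -(natr1 n) (addrA v) addrK.
split=> [s|I].
- rewrite !inE => /orP[]/eqP ->; [exists u, v|exists (u + n.+1%:R), (v + n.+1%:R)].
    by split=> //; left.
  by split=> //; right; rewrite arcE.
- case=> ->; [exists u, v|exists (u + n.+1%:R), (v + n.+1%:R)].
    by rewrite !inE eqxx.
  by rewrite !inE eqxx orbT arcE.
Qed.

Theorem theorem4p3 (R : realType) (n : nat) (hn : (1 <= n)%N)
    (c : R^o * R^o) (r theta : R) (hr : 0 < r)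
    (D1 D2 : {set {set label n}})
    (hD1 : is_Bdiagonal D1) (hD2 : is_Bdiagonal D2)
    (u1 v1 u2 v2 : label n)
    (h1 : represents u1 v1 D1) (h2 : represents u2 v2 D2) :
  ~ crossing c r theta D1 D2 <->
  (forall I J : set (circle R n),
     arc_rep u1 v1 I -> arc_rep u2 v2 J ->
     nested I J \/ I `&` J = set0).
Proof.
have [d1 hd1 [D1P A1P]] := representsP R _ _ _ _ h1.
have [d2 hd2 [D2P A2P]] := representsP R _ _ _ _ h2.
split=> [ncross I J /A1P [w [z [wz wzD ->]]] /A2P [x [y [xy xyD ->]]]|
         nest [s1 [s2 [/D1P [w [z [wz -> I]]] /D2P [x [y [xy -> J]]] d12 meet]]]].
- apply/(arcs_nestedP _ _ _ _ _ _ _ _ hd1 wz hd2 xy)/negP => sep.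
  have wz' := label_neq _ _ _ _ hd1 wz; have xy' := label_neq _ _ _ _ hd2 xy.
  (* Alternating diagonals share no endpoint, hence are distinct, as [crossing] demands. *)
  have d12 : [set w; z]%SET != [set x; y]%SET.
    apply/eqP => /setP /(_ x); rewrite !inE eqxx /=.
    by case/and5P: sep; rewrite !val_eqE => /negPf -> /negPf ->.
  apply: ncross; exists [set w; z]%SET, [set x; y]%SET; split=> //.
  exact/chords_meetP.
- have := nest _ _ I J.
  move/(arcs_nestedP _ _ _ _ _ _ _ _ hd1 wz hd2 xy)/negP; apply.
  apply/(chords_meetP R n c r theta) => //.
  + exact: label_neq hd1 wz.
  + exact: label_neq hd2 xy.
Qed.
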